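(* Let $n\ge 0$ and for a permutation $\sigma=\sigma_1\cdots\sigma_n\in\mathfrak{S}_n$ let $\operatorname{inv}(\sigma)$, $\operatorname{iasc}(\sigma)$, $\operatorname{isol}(\sigma)$, $\operatorname{des}(\sigma)$ and $\operatorname{RLmin}(\sigma)$ be as defined in the context. Define the cycle $q$-inv-Roselle polynomials \[ F^{\mathrm{inv}}_n(q;x,y,z\mid\beta)=\sum_{\sigma\in\mathfrak{S}_n} q^{\operatorname{inv}(\sigma)}x^{\operatorname{iasc}(\sigma)}z^{\operatorname{isol}(\sigma)}y^{\operatorname{des}(\sigma)-1}\beta^{\operatorname{RLmin}(\sigma)}\quad(n\ge1),\qquad F^{\mathrm{inv}}_0=1. \] Then, as formal power series in $u$, \[ \sum_{n\ge 0}F^{\mathrm{inv}}_n(q;x,y,z\mid\beta)\frac{u^n}{(q;q)_n} =\prod_{k=0}^{\infty}\frac{1-x^{-1}y\,e_q\big((x-y)uq^{k+1}\big)}{1-\beta uq^k(z-y)-x^{-1}y\big(1+\beta uq^k(x-z)\big)\,e_q\big((x-y)uq^{k+1}\big)}. \]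
   Context: $\mathfrak{S}_n$ is the set of permutations of $\{1,\dots,n\}$, written in one-line notation $\sigma=\sigma_1\cdots\sigma_n$, with the convention $\sigma_0=\sigma_{n+1}=0$. For $0\le i\le n$, $i$ is a descent if $\sigma_i>\sigma_{i+1}$ and an ascent otherwise; $\operatorname{des}(\sigma)$ and $\operatorname{asc}(\sigma)$ are their numbers. $\operatorname{inv}(\sigma)=\#\{(i,j):1\le i<j\le n,\ \sigma_i>\sigma_j\}$. A right-to-left minimum of $\sigma$ is an entry $\sigma_i$ with $\sigma_i<\sigma_j$ for all $j>i$; $\operatorname{RLmin}(\sigma)$ is their number. Place a bar at the beginning of $\sigma$ and a bar immediately after each right-to-left minimum; an entry $\sigma_j$ is isolated if it is the only entry between two consecutive bars, and $\operatorname{isol}(\sigma)$ is the number of isolated entries. An index $0\le i\le n-1$ is a non-isolated ascent if $i$ is an ascent and $\sigma_{i+1}$ is not isolated; $\operatorname{iasc}(\sigma)$ is their number. Here $(q;q)_n=\prod_{i=1}^n(1-q^i)$ and $e_q(u)=\sum_{n\ge0}u^n/(q;q)_n$. *)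

(* Defs.v *)
From mathcomp Require Import all_boot all_order all_algebra all_fingroup.
Set Implicit Arguments. Unset Strict Implicit. Unset Printing Implicit Defensive.
Import GRing.Theory.

(* A permutation s : 'S_n of {0..n-1} is read as the word
   sigma_1 ... sigma_n with sigma_i = (s (i-1)) + 1 in {1..n},
   and the convention sigma_0 = sigma_(n+1) = 0.                       *)
Section Stats.
Variable n : nat.
Implicit Type s : 'S_n.

Definition word s : seq nat := [seq (s i).+1 | i <- enum 'I_n].
(* sig s i = sigma_i for 0 <= i <= n+1 (0 at both ends) *)
Definition sig s (i : nat) : nat := nth 0 (0 :: word s) i.

Definition is_descent s (i : nat) : bool := sig s i.+1 < sig s i.
Definition is_ascent s (i : nat) : bool := ~~ is_descent s i.
Definition des s : nat := count (is_descent s) (iota 0 n.+1).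
Definition asc s : nat := count (is_ascent s) (iota 0 n.+1).

Definition inv s : nat :=
  count (fun p : nat * nat => (p.1 < p.2) && (sig s p.2 < sig s p.1))
        [seq (i, j) | i <- iota 1 n, j <- iota 1 n].

Definition is_RLmin s (i : nat) : bool :=
  (1 <= i <= n) && all (fun j => sig s i < sig s j) (iota i.+1 (n - i)).
Definition RLmin s : nat := count (is_RLmin s) (iota 1 n).

(* there is a bar immediately after position p: p = 0 is the bar at the
   beginning, otherwise sigma_p must be a right-to-left minimum *)
Definition is_bar s (p : nat) : bool := (p == 0) || is_RLmin s p.
(* sigma_j is isolated: it is the only entry between two consecutive bars *)
Definition is_isolated s (j : nat) : bool :=
  [&& 1 <= j <= n, is_bar s j.-1 & is_bar s j].
Definition isol s : nat := count (is_isolated s) (iota 1 n).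

Definition iasc s : nat :=
  count (fun i => is_ascent s i && ~~ is_isolated s i.+1) (iota 0 n).
End Stats.

Local Open Scope ring_scope.
Section Series.
Variable K : fieldType.

(* formal power series in q over K: coefficient sequence (coef of q^m) *)
Definition qser := nat -> K.
Definition qconst (c : K) : qser := fun m => if m == 0%N then c else 0.
Definition qmono (c : K) (d : nat) : qser := fun m => if m == d then c else 0.
Definition qadd (f g : qser) : qser := fun m => f m + g m.
Definition qopp (f : qser) : qser := fun m => - f m.
Definition qmul (f g : qser) : qser :=
  fun m => \sum_(i < m.+1) f i * g (m - i)%N.
(* multiplicative inverse (for f 0 != 0), by the usual recursion
   g_0 = f_0^-1, g_m = - f_0^-1 * sum_(i=1..m) f_i g_(m-i) *)
Fixpoint qinv_seq (f : qser) (m : nat) : seq K :=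
  match m with
  | 0 => [:: (f 0%N)^-1]
  | m'.+1 => let l := qinv_seq f m' in
      rcons l (- (f 0%N)^-1 * \sum_(i < m'.+1) f i.+1 * nth 0 l (m' - i)%N)
  end.
Definition qinv (f : qser) : qser := fun m => nth 0 (qinv_seq f m) m.

(* formal power series in u with coefficients in K[[q]]:
   f n = coefficient of u^n (a q-series); so f n m = coef of u^n q^m *)
Definition user := nat -> qser.
Definition uconst (c : K) : user := fun n => if n == 0%N then qconst c else qconst 0.
Definition uone : user := uconst 1.
Definition umono (c : K) (k : nat) : user :=
  fun n => if n == 1%N then qmono c k else qconst 0.
Definition uadd (f g : user) : user := fun n => qadd (f n) (g n).
Definition uopp (f : user) : user := fun n => qopp (f n).
Definition umul (f g : user) : user :=
  fun n => \big[qadd/qconst 0]_(i < n.+1) qmul (f i) (g (n - i)%N).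
Fixpoint uinv_seq (f : user) (n : nat) : seq qser :=
  match n with
  | 0 => [:: qinv (f 0%N)]
  | n'.+1 => let l := uinv_seq f n' in
      rcons l (qmul (qopp (qinv (f 0%N)))
                 (\big[qadd/qconst 0]_(i < n'.+1)
                     qmul (f i.+1) (nth (qconst 0) l (n' - i)%N)))
  end.
Definition uinv (f : user) : user := fun n => nth (qconst 0) (uinv_seq f n) n.

(* convergence in the formal ((u,q)-adic) topology: every coefficient
   of u^n q^m is eventually constant, equal to that of L *)
Definition converges_to (P : nat -> user) (L : user) : Prop :=
  forall n m : nat, exists N0 : nat, forall N : nat, (N0 <= N)%N -> P N n m = L n m.

Definition qpoch (n : nat) : qser :=
  \big[qmul/qconst 1]_(i < n) qadd (qconst 1) (qopp (qmono 1 i.+1)).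

(* e_q(a u q^s) = sum_n a^n q^(s n) u^n / (q;q)_n, as a u-series *)
Definition eq_exp (a : K) (s : nat) : user :=
  fun n => qmul (qmono (a ^+ n) (n * s)%N) (qinv (qpoch n)).

Definition Finv (x y z b : K) (n : nat) : qser :=
  if n is 0 then qconst 1 else
  \big[qadd/qconst 0]_(s : 'S_n)
     qmono (x ^+ iasc s * z ^+ isol s * y ^+ (des s - 1) * b ^+ RLmin s) (inv s).

Definition Fgen (x y z b : K) : user :=
  fun n => qmul (Finv x y z b n) (qinv (qpoch n)).

End Series.

(* Main.v *)
(** Read a permutation through its Lehmer code c_1 ... c_n, where c_i counts
    the later entries smaller than sigma_i and ranges freely over 0..n-i: inv is
    the sum of the code, an interior i is a descent iff c_(i+1) < c_i, and sigma_i
    is a right-to-left minimum iff c_i = 0.  Hence F_n is a transfer sum H_n(0),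
    where H_n(a) runs over codes of length n preceded by the letter a.  The
    relation H_(n+1)(a) - H_(n+1)(a+1) = (x - y) q^a H_n(a), for 1 <= a <= n,
    expands H_(n+1)(1) along the diagonal values H_(r+1)(r+1); on generating
    functions in u this is a multiplication by E = e_q((x - y) u q).  With
    S_n = sum_(c >= 1) q^c H_n(c), all of H_(n+1)(0), H_(n+1)(1) and
    H_(n+1)(n+1) are linear in H_n(0) and S_n, and eliminating S gives
    F(u) D_0(u) = N_0(u) F(q u).  Iterating u := q u yields the product. *)
Require Import Defs.
From HB Require Import structures.
From mathcomp Require Import all_boot all_order all_algebra all_fingroup.
From mathcomp Require Import boolp ring zify.
Set Implicit Arguments. Unset Strict Implicit. Unset Printing Implicit Defensive.
Import GRing.Theory.
Local Open Scope ring_scope.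

(** * Formal power series *)

Definition fps (R : comNzRingType) : Type := nat -> R.

Section PowerSeries.
Variable R : comNzRingType.
Implicit Types f g h : fps R.

(* The zero of the ring is [fps_const 0] rather than [fun=> 0], so that the ring
   operations of [fps K] and [fps (fps K)] are convertible to those on [qser K]
   and [user K]. *)
Definition fps_const (c : R) : fps R := fun m => if m == 0%N then c else 0.
Definition fps_add f g : fps R := fun m => f m + g m.
Definition fps_opp f : fps R := fun m => - f m.
Definition fps_mul f g : fps R :=
  fun m => \sum_(i < m.+1) f i * g (m - i)%N.

Lemma fps_addA : associative fps_add.
Proof. by move=> f g h; apply/funext => m; rewrite /fps_add addrA. Qed.
Lemma fps_addC : commutative fps_add.
Proof. by move=> f g; apply/funext => m; rewrite /fps_add addrC. Qed.
Lemma fps_add0 : left_id (fps_const 0) fps_add.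
Proof.
by move=> f; apply/funext => m; rewrite /fps_add /fps_const if_same add0r.
Qed.
Lemma fps_addN : left_inverse (fps_const 0) fps_opp fps_add.
Proof.
by move=> f; apply/funext=> m; rewrite /fps_add /fps_opp addNr /fps_const if_same.
Qed.

Definition fps_trunc n f : {poly R} := \poly_(i < n.+1) f i.

(** Coefficients up to [n] see only the truncations, so commutativity and associativity are
    inherited from polynomials. *)
Lemma fps_mul_trunc n f g m : (m <= n)%N ->
  fps_mul f g m = (fps_trunc n f * fps_trunc n g)`_m.
Proof.
move=> le_mn; rewrite coefM; apply: eq_bigr => i _; rewrite !coef_poly.
have lt_im := ltn_ord i.
by rewrite (leq_trans lt_im) // ltnS (leq_trans (leq_subr _ _)).
Qed.

Lemma fps_mulC : commutative fps_mul.
Proof.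
by move=> f g; apply/funext => m; rewrite !(fps_mul_trunc _ _ (leqnn m)) mulrC.
Qed.

Lemma fps_mulA : associative fps_mul.
Proof.
(* Truncating a product and multiplying truncations differ only above degree [n]; the factor [p]
   cannot bring that difference down to degree [m]. *)
have trunc_mul n f g p : forall m, (m <= n)%N ->
    (fps_trunc n (fps_mul f g) * p)`_m
    = (fps_trunc n f * fps_trunc n g * p)`_m.
  move=> m le_mn; rewrite !coefM; apply: eq_bigr => i _.
  have lt_in : (i < n.+1)%N by rewrite (leq_trans (ltn_ord i)).
  by rewrite coef_poly lt_in (fps_mul_trunc _ _ (lt_in : i <= n)%N).
move=> f g h; apply/funext => m.
rewrite !(fps_mul_trunc _ _ (leqnn m)) trunc_mul //.
by rewrite (mulrC (fps_trunc m f)) trunc_mul // mulrC mulrA.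
Qed.

Lemma fps_mul1 : left_id (fps_const 1) fps_mul.
Proof.
move=> f; apply/funext => m; rewrite /fps_mul big_ord_recl /= mul1r subn0.
by rewrite big1 ?addr0 // => i _; rewrite mul0r.
Qed.

Lemma fps_mulDl : left_distributive fps_mul fps_add.
Proof.
move=> f g h; apply/funext => m; rewrite /fps_add /fps_mul -big_split /=.
by apply: eq_bigr => i _; rewrite mulrDl.
Qed.

End PowerSeries.

HB.instance Definition _ (R : comNzRingType) := gen_eqMixin (fps R).
HB.instance Definition _ (R : comNzRingType) := gen_choiceMixin (fps R).
HB.instance Definition _ (R : comNzRingType) :=
  GRing.isZmodule.Build (fps R) (@fps_addA R) (@fps_addC R)
    (@fps_add0 R) (@fps_addN R).
Fact fps_1_neq0 (R : comNzRingType) : fps_const 1 != 0 :> fps R.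
Proof.
apply/eqP => /(congr1 (@^~ 0%N)); rewrite /fps_const /=.
by move/eqP; rewrite oner_eq0.
Qed.
HB.instance Definition _ (R : comNzRingType) :=
  GRing.Zmodule_isComNzRing.Build (fps R) (@fps_mulA R) (@fps_mulC R)
    (@fps_mul1 R) (@fps_mulDl R) (@fps_1_neq0 R).

Section PowerSeriesTheory.
Variable R : comNzRingType.
Implicit Types (f g : fps R) (c : R).

Definition fps_mono c d : fps R := fun m => if m == d then c else 0.

Lemma coef_fpsM f g n : (f * g) n = \sum_(i < n.+1) f i * g (n - i)%N.
Proof. by []. Qed.

Lemma coef_fpsD f g n : (f + g) n = f n + g n.
Proof. by []. Qed.

Lemma coef_fpsN f n : (- f) n = - f n.
Proof. by []. Qed.

Lemma coef0_fpsM f g : (f * g) 0%N = f 0%N * g 0%N.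
Proof. by rewrite coef_fpsM big_ord1. Qed.

Lemma coef_fps_monoM c d f n :
  (fps_mono c d * f) n = if (d <= n)%N then c * f (n - d)%N else 0.
Proof.
rewrite coef_fpsM; case: leqP => [le_dn|lt_nd].
  rewrite (bigD1 (Ordinal (le_dn : (d < n.+1)%N))) //= /fps_mono eqxx big1 => [|i].
    by rewrite addr0.
  by rewrite -val_eqE /= => /negPf ->; rewrite mul0r.
rewrite big1 // => i _; rewrite /fps_mono ltn_eqF ?mul0r //.
exact: leq_trans (ltn_ord i) lt_nd.
Qed.

Lemma fps_monoM c c' d d' :
  fps_mono c d * fps_mono c' d' = fps_mono (c * c') (d + d').
Proof.
apply/funext=> n; rewrite coef_fps_monoM /fps_mono.
case: leqP => [le_dn|lt_nd].
  by rewrite -(eqn_add2l d) subnKC //; case: eqP; rewrite ?mulr0.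
by rewrite ltn_eqF // (leq_trans lt_nd) // leq_addr.
Qed.

Lemma fps_monoX d : fps_mono 1 1 ^+ d = fps_mono 1 d.
Proof. by elim: d => // d IHd; rewrite exprS IHd fps_monoM mulr1. Qed.

Lemma fps_monoE c d : fps_mono c d = fps_const c * fps_mono 1 1 ^+ d.
Proof. by rewrite fps_monoX [RHS]fps_monoM mulr1. Qed.

Lemma coef_fps_constM c f n : (fps_const c * f) n = c * f n.
Proof. by rewrite [LHS]coef_fps_monoM subn0. Qed.

Lemma fps_constM c c' : fps_const (c * c') = fps_const c * fps_const c'.
Proof. by rewrite [RHS]fps_monoM. Qed.

Lemma fps_constB c c' : fps_const (c - c') = fps_const c - fps_const c'.
Proof.
by apply/funext=> n; rewrite coef_fpsD coef_fpsN /fps_const; case: eqP; rewrite ?subr0.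
Qed.

Lemma fps_constX c n : fps_const (c ^+ n) = fps_const c ^+ n.
Proof. by elim: n => // n IHn; rewrite !exprS fps_constM IHn. Qed.

(** The inverse [i0] of the constant term is a parameter, so one recursion serves both for
    coefficients in [K] and for coefficients that are series in q. *)
Fixpoint fps_inv_seq (i0 : R) f (m : nat) : seq R :=
  match m with
  | 0 => [:: i0]
  | m'.+1 => let l := fps_inv_seq i0 f m' in
      rcons l (- i0 * \sum_(i < m'.+1) f i.+1 * nth 0 l (m' - i)%N)
  end.
Definition fps_inv (i0 : R) f : fps R := fun m => nth 0 (fps_inv_seq i0 f m) m.

Lemma size_fps_inv_seq i0 f m : size (fps_inv_seq i0 f m) = m.+1.
Proof. by elim: m => //= m IHm; rewrite size_rcons IHm. Qed.

Lemma nth_fps_inv_seq i0 f m i : (i <= m)%N ->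
  nth 0 (fps_inv_seq i0 f m) i = fps_inv i0 f i.
Proof.
elim: m => [|m IHm]; first by rewrite leqn0 => /eqP ->.
rewrite leq_eqVlt => /predU1P[-> //|le_im].
by rewrite /= nth_rcons size_fps_inv_seq le_im IHm.
Qed.

Lemma fps_mulV i0 f : f 0%N * i0 = 1 -> f * fps_inv i0 f = 1.
Proof.
move=> f0K; apply/funext=> -[|m]; first by rewrite coef0_fpsM.
rewrite coef_fpsM big_ord_recl {1}/fps_inv /= nth_rcons size_fps_inv_seq ltnn eqxx.
rewrite mulNr mulrN mulrA f0K mul1r; apply/eqP; rewrite addrC subr_eq0; apply/eqP.
apply: eq_bigr => i _; rewrite subSS nth_fps_inv_seq ?leq_subr //.
Qed.
End PowerSeriesTheory.

(** * The substitution u := q^k u *)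

Section Scaling.
Variables (R : comNzRingType) (q : R).
Implicit Types f g : fps R.

Definition scale k f : fps R := fun n => q ^+ (n * k) * f n.

Lemma scaleD k f g : scale k (f + g) = scale k f + scale k g.
Proof. by apply/funext=> n; exact: mulrDr. Qed.

Lemma scaleN k f : scale k (- f) = - scale k f.
Proof. by apply/funext=> n; exact: mulrN. Qed.

Lemma scaleM k f g : scale k (f * g) = scale k f * scale k g.
Proof.
apply/funext=> n; rewrite /scale !coef_fpsM mulr_sumr; apply: eq_bigr => i _.
have le_in : (i <= n)%N by rewrite -ltnS.
by rewrite -{1}(subnKC le_in) mulnDl exprD mulrACA.
Qed.

Lemma scale_mono k c d : scale k (fps_mono c d) = fps_mono (c * q ^+ (d * k)) d.
Proof.
apply/funext=> n; rewrite /scale /fps_mono.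
by case: eqP => [->|_]; rewrite ?mulr0 // mulrC.
Qed.

Lemma scale_const k c : scale k (fps_const c) = fps_const c.
Proof. by rewrite [LHS]scale_mono expr0 mulr1. Qed.

Lemma scale_scale k l f : scale k (scale l f) = scale (k + l) f.
Proof. by apply/funext=> n; rewrite /scale mulrA -exprD -mulnDr. Qed.

Lemma scale0 f : scale 0 f = f.
Proof. by apply/funext=> n; rewrite /scale muln0 mul1r. Qed.
End Scaling.

(** * The transfer sum over codes *)

Section CodeRecursion.
Variables (R : comNzRingType) (q x y z b : R).

(** The factor of a letter [c] preceded by [p], apart from its power of q. A zero after a zero is an
    isolated entry; a zero after a positive letter is a descent to a right-to-left minimum; a
    positive letter is a descent or a non-isolated ascent. *)
Definition step (p c : nat) : R :=
  if c == 0%N then (if p == 0%N then z else y) * b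
  else if (c < p)%N then y else x.

Fixpoint code_sum (n a : nat) : R :=
  if n is m.+1 then \sum_(c < n) q ^+ c * step a c * code_sum m c else 1.

Definition pos_sum n : R := \sum_(c < n) q ^+ c.+1 * code_sum n c.+1.

Lemma code_sum0 n :
  code_sum n.+1 0 = z * b * code_sum n 0 + x * pos_sum n.
Proof.
rewrite /= big_ord_recl /step /= expr0 mul1r; congr (_ + _).
rewrite mulr_sumr; apply: eq_bigr => c _.
by rewrite /bump /= add1n mulrA [x * _]mulrC.
Qed.

Lemma code_sum1 n :
  code_sum n.+1 1 = y * b * code_sum n 0 + x * pos_sum n.
Proof.
rewrite /= big_ord_recl /step /= expr0 mul1r; congr (_ + _).
rewrite mulr_sumr; apply: eq_bigr => c _.
by rewrite /bump /= add1n mulrA [x * _]mulrC.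
Qed.

(** The first letter is at most [n], so after [n.+1] every positive choice is a descent. *)
Lemma code_sum_diag n :
  code_sum n.+1 n.+1 = y * b * code_sum n 0 + y * pos_sum n.
Proof.
rewrite /= big_ord_recl /step /= expr0 mul1r; congr (_ + _).
rewrite mulr_sumr; apply: eq_bigr => c _.
by rewrite /bump /= add1n ltnS ltn_ord mulrA [y * _]mulrC.
Qed.

(** Raising the preceding letter from [a] to [a.+1] affects only the first letter [a], whose factor
    passes from [x] to [y]; as [a] is positive, the factor of a zero stays [y * b]. *)
Lemma code_sum_succ n a : (0 < a <= n)%N ->
  code_sum n.+1 a = code_sum n.+1 a.+1 + (x - y) * q ^+ a * code_sum n a.
Proof.
case/andP=> a_gt0 le_an.
pose a' : 'I_n.+1 := Ordinal (le_an : (a < n.+1)%N).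
rewrite /= (bigD1 a') //= [in RHS](bigD1 a') //=.
have -> : \sum_(i < n.+1 | i != a') q ^+ i * step a i * code_sum n i
        = \sum_(i < n.+1 | i != a') q ^+ i * step a.+1 i * code_sum n i.
  apply: eq_bigr => i ne_ia;
  rewrite /step ltnS (ltn_neqAle i a) -[i == a :> nat]/(i == a').
  by rewrite ne_ia (gtn_eqF a_gt0).
rewrite /step (gtn_eqF a_gt0) ltnn ltnSn; ring.
Qed.

Local Arguments code_sum : simpl never.

(** [rho n] stands for 1/(q;q)_n. *)
Variable rho : nat -> R.
Hypothesis rho0 : rho 0 = 1.
Hypothesis rhoS : forall n, (1 - q ^+ n.+1) * rho n.+1 = rho n.
Hypothesis reg : forall n, GRing.lreg (1 - q ^+ n.+1).

(** The weights are the coefficients of e_q((x - y) u q^a). Induction on the gap [d] for all [a]: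
    [code_sum_succ] gives two sums of gap [d], preceded by [a.+1] and by [a], recombined after
    multiplication by 1 - q^(d+1). *)
Lemma code_sum_expand d a : (0 < a)%N ->
  code_sum (a + d) a * rho d
  = \sum_(k < d.+1) (x - y) ^+ k * q ^+ (a * k) * rho k
       * (code_sum (a + (d - k)) (a + (d - k)) * rho (d - k)%N).
Proof.
elim: d a => [|d IHd] a a_gt0.
  by rewrite big_ord1 muln0 subnn addn0 !expr0 rho0 !mul1r mulr1.
apply: (@reg d); rewrite mulrCA rhoS addnS code_sum_succ ?a_gt0 ?leq_addr //.
rewrite -addSn [LHS]mulrDl (IHd a.+1) //.
rewrite -(mulrA ((x - y) * q ^+ a)) IHd // !mulr_sumr.
(* [1 - q^(d+1) = (q^k - q^(d+1)) + (1 - q^k)] in the k-th term: the first part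
   lowers [rho (d+1-k)] to [rho (d-k)], the second lowers [rho k] to [rho (k-1)]. *)
transitivity (\sum_(k < d.+2) (q ^+ k - q ^+ d.+1) * ((x - y) ^+ k * q ^+ (a * k) * rho k
       * (code_sum (a + (d.+1 - k)) (a + (d.+1 - k)) * rho (d.+1 - k)%N))
  + \sum_(k < d.+2) (1 - q ^+ k) * ((x - y) ^+ k * q ^+ (a * k) * rho k
       * (code_sum (a + (d.+1 - k)) (a + (d.+1 - k)) * rho (d.+1 - k)%N))).
  rewrite [X in _ = X + _]big_ord_recr [X in _ = _ + X]big_ord_recl /=.
  rewrite subrr mul0r addr0 expr0 subrr mul0r add0r; congr (_ + _).
    apply: eq_bigr => k _; have le_kd : (k <= d)%N by rewrite -ltnS.
    rewrite subSn // -(rhoS (d - k)) addSn addnS mulSn exprD.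
    have -> : q ^+ d.+1 = q ^+ k * q ^+ (d - k).+1 by rewrite -exprD addnS subnKC.
    ring.
  apply: eq_bigr => k _; rewrite /bump /= add1n subSS -(rhoS k) mulnS exprD !exprS.
  ring.
rewrite -big_split /=; apply: eq_bigr => k _; ring.
Qed.
End CodeRecursion.

(** * Lehmer codes *)

Fixpoint lehmer (w : seq nat) : seq nat :=
  if w is a :: w' then count (ltn^~ a) w' :: lehmer w' else [::].

Lemma size_lehmer w : size (lehmer w) = size w.
Proof. by elim: w => //= a w ->. Qed.

Lemma nth_lehmer w i : (i < size w)%N ->
  nth 0%N (lehmer w) i = count (ltn^~ (nth 0%N w i)) (drop i.+1 w).
Proof. by elim: w i => // a w IHw [|i] /= lt_iw; [rewrite drop0 | apply: IHw]. Qed.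

(** At a descent, position [i] counts all that position [i.+1] counts and the entry at [i.+1] as
    well; otherwise it counts no more than position [i.+1] does. *)
Lemma lehmer_descent w i : (i.+1 < size w)%N ->
  (nth 0 w i.+1 < nth 0 w i)%N = (nth 0 (lehmer w) i.+1 < nth 0 (lehmer w) i)%N.
Proof.
move=> lt_iw; rewrite !nth_lehmer ?(ltnW lt_iw) // (drop_nth 0%N lt_iw) /=.
case: ltnP => [lt_w|le_w]; rewrite ?add1n ?add0n.
  rewrite ltnS; apply/esym/sub_count => u /= /ltn_trans; exact.
apply/esym/negbTE; rewrite -leqNgt; apply: sub_count => u /= lt_u.
exact: leq_trans lt_u le_w.
Qed.

Lemma lehmer_rl_min w i : uniq w -> (i < size w)%N ->
  (nth 0%N (lehmer w) i == 0)%N = all (ltn (nth 0%N w i)) (drop i.+1 w).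
Proof.
move=> Uw lt_iw; rewrite nth_lehmer // -leqn0 leqNgt -has_count -all_predC.
apply: eq_in_all => u u_w /=; rewrite -leqNgt leq_eqVlt.
suff -> : (nth 0%N w i == u) = false by [].
apply/negbTE/eqP=> eq_u; move: Uw; rewrite -(cat_take_drop i.+1 w) cat_uniq.
case/and3P=> _ /hasP[]; exists u; rewrite // -eq_u (take_nth 0%N) //.
by rewrite mem_rcons mem_head.
Qed.

Lemma size_word n (s : 'S_n) : size (word s) = n.
Proof. by rewrite size_map size_enum_ord. Qed.

Lemma uniq_word n (s : 'S_n) : uniq (word s).
Proof. by rewrite map_inj_uniq ?enum_uniq // => i j [] /val_inj /perm_inj. Qed.

Definition code n (s : 'S_n) := lehmer (word s).

Lemma lehmer_map (f : nat -> nat) w : {mono f : i j / (i < j)%N} ->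
  lehmer (map f w) = lehmer w.
Proof.
move=> f_mono; elim: w => //= a w ->; congr (_ :: _).
by rewrite count_map; apply: eq_count => u /=.
Qed.

(** Prefixing a value shifts the other values monotonically, which keeps their code; the new first
    letter counts the [i] smaller values. *)
Lemma code_lift_perm n (i : 'I_n.+1) (t : 'S_n) :
  code (lift_perm ord0 i t) = (i : nat) :: code t.
Proof.
rewrite /code {1}/word enum_ordSl /= lift_perm_id.
have -> : [seq (lift_perm ord0 i t j).+1 | j <- map (lift ord0) (enum 'I_n)]
        = map (bump i.+1) (word t).
  rewrite /word -!map_comp; apply: eq_map => k.
  by rewrite /= lift_perm_lift /= /bump ltnS addnS.
rewrite lehmer_map; last first.
  move=> u v; rewrite /bump; lia.
congr (_ :: _).
have eqp : perm_eq (word t) (iota 1 n).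
  apply: uniq_perm; rewrite ?uniq_word ?iota_uniq // => u.
  apply/mapP/idP => [[k _ ->]|]; first by rewrite mem_iota /= add1n ltnS.
  case: u => [|u]; rewrite mem_iota // add1n ltnS /= => lt_un.
  exists (perm_inv t (Ordinal (lt_un : (u < n)%N))); rewrite ?mem_enum //.
  by rewrite /= permKV.
rewrite (seq.permP (perm_map (bump i.+1) eqp)) count_map.
move: (ltn_ord i); rewrite ltnS; move: (nat_of_ord i) => {}i le_in.
(* The values 1..i are fixed by [bump i.+1] and are counted; the larger ones are moved above [i.+1]
   and are not. *)
rewrite -(subnKC le_in) iotaD count_cat (eq_in_count (a2 := predT)) => [|u]; last first.
  rewrite mem_iota /= /bump => /andP[_ lt_u]; lia.
rewrite count_predT size_iota (eq_in_count (a2 := pred0)) ?count_pred0 ?addn0 // => u.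
rewrite mem_iota /= /bump => /andP[le_u _]; lia.
Qed.

(** The first letter is free: [lift_perm] is injective on pairs, hence bijective because (n+1) n! =
    (n+1)!. *)
Lemma sum_perm_code (V : nmodType) n (Phi : seq nat -> V) :
  \sum_(s : 'S_n.+1) Phi (code s)
  = \sum_(c < n.+1) \sum_(t : 'S_n) Phi ((c : nat) :: code t).
Proof.
rewrite pair_big /=.
pose g (p : 'I_n.+1 * 'S_n) := lift_perm ord0 p.1 p.2.
have g_inj : injective g.
  move=> [i t] [j u] /= eq_g.
  have eq_ij : i = j.
    by rewrite -(lift_perm_id ord0 i t) -[j](lift_perm_id ord0 j u) -/(g (i,t)) eq_g.
  rewrite eq_ij in eq_g *; congr (_, _); apply/permP=> k; apply: (@lift_inj _ j).
  by rewrite -!(lift_perm_lift ord0) -/(g (j, t)) eq_g.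
have g_bij : bijective g.
  apply: inj_card_bij => //.
  by rewrite card_prod card_ord !card_Sn factS.
rewrite (reindex g) /=; last by case: g_bij => h hK gK; exists h => p _.
by apply: eq_bigr => -[i t] _; rewrite /= code_lift_perm.
Qed.

(** * Statistics of a permutation in terms of its code *)

Section CodeStatistics.
Variables (n : nat) (s : 'S_n).
Let cur i := nth 0%N (code s) i.
(** The fictitious leading 0 makes index 0 an ascent and accounts for the bar at the beginning. *)
Let prev i := nth 0%N (0%N :: code s) i.

Lemma descent_code i : (i < n)%N -> is_descent s i = (cur i < prev i)%N.
Proof.
case: i => [|i] lt_in; first by rewrite /is_descent /prev /= !ltn0.
by rewrite /is_descent /sig /= lehmer_descent // size_word.
Qed.

Lemma drop_word i : drop i (word s) = map (sig s) (iota i.+1 (n - i)).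
Proof.
rewrite -addn1 addnC iotaDl -map_comp.
rewrite (eq_map (_ : sig s \o addn 1 =1 nth 0%N (word s))) //.
by rewrite map_nth_iota ?size_word // take_oversize // size_drop size_word.
Qed.

Lemma RLmin_code i : (i < n)%N -> is_RLmin s i.+1 = (cur i == 0)%N.
Proof.
move=> lt_in; rewrite /is_RLmin /= lt_in /= /cur lehmer_rl_min ?uniq_word ?size_word //.
by rewrite drop_word all_map.
Qed.

Lemma isolated_code i : (i < n)%N ->
  is_isolated s i.+1 = (prev i == 0)%N && (cur i == 0)%N.
Proof.
move=> lt_in; rewrite /is_isolated /= lt_in /= /is_bar (RLmin_code lt_in) /=.
by case: i lt_in => // i lt_in; rewrite /= RLmin_code // ltnW.
Qed.

Lemma inv_code : Defs.inv s = sumn (code s).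
Proof.
rewrite /Defs.inv count_flatten -map_comp; congr sumn.
apply: (@eq_from_nth _ 0%N) => [|i].
  by rewrite size_map size_iota size_lehmer size_word.
rewrite size_map size_iota => lt_in.
rewrite (nth_map 0%N) ?size_iota // nth_iota //= count_map nth_lehmer ?size_word //.
rewrite drop_word count_map (_ : iota 1 n = iota 1 i.+1 ++ iota i.+2 (n - i.+1)); last first.
  by rewrite -[i.+2]add1n -iotaD subnKC.
rewrite count_cat.
rewrite (eq_in_count (a2 := pred0)) => [|j]; last by rewrite mem_iota /=; lia.
rewrite count_pred0 add0n; apply: eq_in_count => j; rewrite mem_iota /= => /andP[lt_ij _].
by rewrite add1n lt_ij.
Qed.
End CodeStatistics.

(** * The weight of a permutation as a product over its code *)

Section CodeWeight.
Variables (R : comNzRingType) (q x y z b : R).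

Fixpoint code_weight (p : nat) (c : seq nat) : R :=
  if c is a :: c' then q ^+ a * step x y z b p a * code_weight a c' else 1.

Lemma sum_code_weight n a :
  \sum_(s : 'S_n) code_weight a (code s) = code_sum q x y z b n a.
Proof.
elim: n a => [|n IHn] a /=.
  rewrite (eq_bigr (fun=> 1)) => [|s _].
    by rewrite sumr_const card_Sn.
  by rewrite [code s]size0nil // size_lehmer size_word.
rewrite sum_perm_code; apply: eq_bigr => c _.
by rewrite -IHn mulr_sumr.
Qed.

Lemma code_weight_prod p c : code_weight p c
  = q ^+ sumn c * \prod_(i < size c) step x y z b (nth 0%N (p :: c) i) (nth 0%N c i).
Proof.
elim: c p => [|a c IHc] p; first by rewrite big_ord0 mulr1.
rewrite /= big_ord_recl /= IHc exprD; ring.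
Qed.

Lemma expr_count T (r : R) (P : pred T) (l : seq T) :
  r ^+ count P l = \prod_(i <- l) r ^+ P i.
Proof.
by elim: l => [|i l IHl]; rewrite ?big_nil // big_cons /= exprD IHl.
Qed.

Lemma code_weight_stats n (s : 'S_n.+1) :
  code_weight 0 (code s)
  = x ^+ iasc s * z ^+ isol s * y ^+ (des s - 1) * b ^+ RLmin s * q ^+ Defs.inv s.
Proof.
rewrite code_weight_prod -inv_code size_lehmer size_word [RHS]mulrC; congr (_ * _).
have -> : (des s - 1)%N = count (is_descent s) (iota 0 n.+1).
  rewrite /des -[X in (count _ (iota 0 X) - 1)%N]addn1 iotaD count_cat add0n /=.
  (* The final descent to the conventional 0 always occurs; it is the one removed by [des s - 1]. *)
  have -> : is_descent s n.+1.
    rewrite /is_descent /sig /= [nth 0%N _ n.+1]nth_default ?size_word //.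
    by rewrite (nth_map ord_max) ?size_enum_ord.
  by rewrite addn0 addnK.
rewrite /iasc /isol /RLmin (iotaDl 1 0 n.+1 : iota 1 n.+1 = _) !count_map !expr_count.
have iota_ord (F : nat -> R) : \prod_(i <- iota 0 n.+1) F i = \prod_(i < n.+1) F i.
  by rewrite -(big_mkord xpredT F) /index_iota subn0.
rewrite !iota_ord -!big_split /=.
apply: eq_bigr => i _; have lt_in := ltn_ord i.
rewrite /is_ascent !add1n descent_code // isolated_code // RLmin_code // /step.
set c := nth 0%N _ i; set p := nth 0%N (0%N :: _) i.
case: c => [|c]; case: p => [|p] /=; rewrite ?andbF ?andbT ?ltnS /=; try ring.
by case: ltnP => _ /=; ring.
Qed.
End CodeWeight.

(** * The power series of the statement *)

Section QSeries.
Variable K : fieldType.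
Local Notation Q := (fps K).
Local Notation U := (fps (fps K)).
Local Notation qX := (fps_mono 1 1 : Q).
Implicit Types (x y z b : K).

Lemma qinvE (f : Q) : qinv f = fps_inv (f 0%N)^-1 f.
Proof.
apply/funext=> m; rewrite /qinv /fps_inv; congr nth.
by elim: m => //= m ->.
Qed.

Lemma uinvE (f : U) : uinv f = fps_inv (qinv (f 0%N) : Q) f.
Proof.
apply/funext=> m; rewrite /uinv /fps_inv; congr nth.
by elim: m => //= m ->.
Qed.

Lemma qmonoE c d : qmono c d = (fps_const c : Q) * qX ^+ d.
Proof. exact: fps_monoE. Qed.

Lemma mul_qinv (f : Q) : f 0%N != 0 -> f * (qinv f : Q) = 1.
Proof. by move=> f0; rewrite qinvE fps_mulV // mulfV. Qed.

Lemma mul_uinv (f : U) : f 0%N 0%N != 0 -> f * (uinv f : U) = 1.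
Proof. by move=> f0; rewrite uinvE fps_mulV // mul_qinv. Qed.

Definition rho n : Q := qinv (qpoch K n).

Lemma qpochE n : qpoch K n = \prod_(i < n) (1 - qX ^+ i.+1) :> Q.
Proof. by apply: eq_bigr => i _; rewrite fps_monoX. Qed.

Lemma qpochK n : (qpoch K n : Q) * rho n = 1.
Proof.
apply: mul_qinv; elim: n => [|n IHn].
  by rewrite /qpoch big_ord0; exact: oner_neq0.
rewrite qpochE big_ord_recr /= -qpochE coef0_fpsM mulf_neq0 // fps_monoX.
by rewrite coef_fpsD coef_fpsN oppr0 addr0 oner_neq0.
Qed.

Lemma rho0 : rho 0 = 1.
Proof. by rewrite -(qpochK 0) qpochE big_ord0 mul1r. Qed.

Lemma qpoch_rhoS n : (qpoch K n : Q) * ((1 - qX ^+ n.+1) * rho n.+1) = 1.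
Proof. by have := qpochK n.+1; rewrite qpochE big_ord_recr -qpochE -mulrA. Qed.

Lemma rhoS n : (1 - qX ^+ n.+1) * rho n.+1 = rho n.
Proof.
(* Both sides are inverses of [qpoch K n]. *)
rewrite -[RHS]mulr1; have {2}<- := qpoch_rhoS n.
by rewrite mulrA [rho n * _]mulrC qpochK mul1r.
Qed.

Lemma lreg_1subqX n : GRing.lreg (1 - qX ^+ n.+1 : Q).
Proof.
have inv_l : ((qpoch K n : Q) * rho n.+1) * (1 - qX ^+ n.+1) = 1.
  by rewrite -mulrA [rho n.+1 * _]mulrC qpoch_rhoS.
by move=> f g /(congr1 ( *%R ((qpoch K n : Q) * rho n.+1))); rewrite !mulrA inv_l !mul1r.
Qed.

Lemma Finv_code_sum x y z b n : Finv x y z b n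
  = code_sum qX (fps_const x) (fps_const y) (fps_const z) (fps_const b) n 0 :> Q.
Proof.
case: n => [//|n]; rewrite -sum_code_weight.
apply: eq_bigr => s _; rewrite code_weight_stats qmonoE.
by rewrite !fps_constM !fps_constX.
Qed.

Variables (x y z b : K).
Local Notation cst c := (fps_const (fps_const c) : U).
Local Notation uX := (fps_mono 1 1 : U).
Local Notation H := (code_sum qX (fps_const x) (fps_const y) (fps_const z) (fps_const b)).
Local Notation F := (Fgen x y z b : U).
Let S : U := fun n =>
  pos_sum qX (fps_const x) (fps_const y) (fps_const z) (fps_const b) n * rho n.

Lemma FgenE n : F n = H n 0 * rho n.
Proof. by rewrite -Finv_code_sum. Qed.

Lemma eq_expE s n :
  (eq_exp (x - y) s : U) n = (fps_const x - fps_const y) ^+ n * qX ^+ (n * s) * rho n.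
Proof. by rewrite -fps_constB -fps_constX -qmonoE. Qed.

(** Both u^n coefficients equal [H n.+1 1 * rho n]: the left one by [code_sum1], the right one by
    expanding along the diagonal with [a = 1]. *)
Lemma Fgen_exp :
  cst y * cst b * F + cst x * S
  = (eq_exp (x - y) 1 : U) * (cst y * cst b * F + cst y * S).
Proof.
apply/funext=> n; rewrite coef_fpsM.
transitivity (H n.+1 1 * rho n).
  rewrite code_sum1 !coef_fpsD -!mulrA !coef_fps_constM FgenE.
  by rewrite /S; ring.
rewrite -[n.+1]add1n code_sum_expand //; first last.
- exact: lreg_1subqX.
- exact: rhoS.
- exact: rho0.
apply: eq_bigr => k _; rewrite eq_expE muln1 mul1n; congr (_ * _).
rewrite add1n code_sum_diag !coef_fpsD -!mulrA !coef_fps_constM FgenE.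
by rewrite /S; ring.
Qed.

(** The factor 1 - q^n lowers [rho n] to [rho n.-1], and [code_sum0] unfolds one letter. *)
Lemma Fgen_diff : F - scale qX 1 F = uX * (cst z * cst b * F + cst x * S).
Proof.
apply/funext=> n; rewrite coef_fps_monoM mul1r.
transitivity ((1 - qX ^+ n) * F n).
  by rewrite mulrBl mul1r -[X in qX ^+ X]muln1.
case: n => [|n]; first by rewrite expr0 subrr mul0r.
rewrite FgenE mulrCA rhoS code_sum0 subSS subn0.
rewrite !coef_fpsD -!mulrA !coef_fps_constM FgenE.
by rewrite /S; ring.
Qed.
End QSeries.

(** * The functional equation and the product *)

Lemma functional_equation_elim (R : comNzRingType) (x xi y z b u e F F1 S : R) :
  xi * x = 1 -> y * b * F + x * S = e * (y * b * F + y * S) ->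
  F - F1 = u * (z * b * F + x * S) ->
  F * (1 + (- (b * (z - y) * u) - xi * y * ((1 + b * (x - z) * u) * e)))
  = (1 - xi * y * e) * F1.
Proof.
move=> xiK expE diffE.
have -> : F1 = F - u * (z * b * F + x * S) by rewrite -diffE subKr.
apply/eqP; rewrite -subr_eq0; apply/eqP.
(* Once [F1] is eliminated, the difference of the sides is [u] times that of [expE], up to the
   factor [xi * x]. *)
transitivity (u * (y * b * F + x * S - xi * x * (e * (y * b * F + y * S)))).
  by ring.
by rewrite xiK mul1r expE subrr mulr0.
Qed.

Section Product.
Variables (K : fieldType) (x y z b : K).
Local Notation Q := (fps K).
Local Notation U := (fps (fps K)).
Local Notation qX := (fps_mono 1 1 : Q).
Local Notation cst c := (fps_const (fps_const c) : U).
Local Notation uX := (fps_mono 1 1 : U).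
Local Notation F := (Fgen x y z b : U).
Local Notation E k := (eq_exp (x - y) k : U).

(** [numer] and [denom] are bracketed to be convertible to the factors of the theorem. *)
Definition numer k : U := 1 - cst (x^-1 * y) * E k.+1.
Definition denom k : U :=
  1 + (- (umono (b * (z - y)) k : U)
       - cst (x^-1 * y) * ((1 + (umono (b * (x - z)) k : U)) * E k.+1)).

Lemma umonoE c k : umono c k = fps_mono (qmono c k : Q) 1 :> U.
Proof. by []. Qed.

Lemma scale_umono c k : scale qX k (umono c 0 : U) = umono c k.
Proof.
by rewrite !umonoE scale_mono mul1n !qmonoE expr0 mulr1.
Qed.

Lemma scale_eq_exp k : scale qX k (E 1) = E k.+1.
Proof.
apply/funext=> n; rewrite /scale !eq_expE muln1 mulnS exprD; ring.
Qed.

Lemma scale_numer k : scale qX k (numer 0) = numer k.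
Proof. by rewrite /numer scaleD scaleN scaleM !scale_const scale_eq_exp. Qed.

Lemma scale_denom k : scale qX k (denom 0) = denom k.
Proof.
by rewrite /denom !(scaleD, scaleN, scaleM) !scale_const !scale_umono scale_eq_exp.
Qed.

Hypotheses (x_neq0 : x != 0) (neq_xy : x != y).

Lemma functional_equation0 : F * denom 0 = numer 0 * scale qX 1 F.
Proof.
have umono0 c : umono c 0 = cst c * uX :> U.
  by rewrite umonoE fps_monoE expr1 qmonoE expr0 mulr1.
have cst_inv : cst x^-1 * cst x = 1 by rewrite -!fps_constM mulVf.
have := functional_equation_elim cst_inv (Fgen_exp x y z b) (Fgen_diff x y z b).
by rewrite /denom /numer !umono0 !fps_constM !fps_constB.
Qed.

Lemma functional_equation k :
  scale qX k F * denom k = numer k * scale qX k.+1 F.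
Proof.
rewrite -scale_denom -scaleM functional_equation0 scaleM scale_numer.
by rewrite scale_scale addn1.
Qed.

Lemma denom00 k : denom k 0%N 0%N = 1 - x^-1 * y.
Proof.
rewrite /denom !(coef_fpsD, coef_fpsN, coef0_fpsM) !umonoE.
rewrite !eq_expE rho0 mul0n !expr0 !mulr1.
by rewrite /fps_mono /= oppr0 add0r addr0 mulr1.
Qed.

Lemma denomK k : denom k * (uinv (denom k) : U) = 1.
Proof.
apply: mul_uinv; rewrite denom00 subr_eq0; apply: contraNneq neq_xy => xVy.
by rewrite -(mulVKf x_neq0 y) -xVy mulr1.
Qed.

Lemma Fgen_prod N :
  F = \prod_(k < N) (numer k * (uinv (denom k) : U)) * scale qX N F.
Proof.
elim: N => [|N IHN]; first by rewrite big_ord0 scale0 mul1r.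
rewrite {1}IHN big_ord_recr /= -mulrA; congr (_ * _).
by rewrite mulrAC -functional_equation -mulrA denomK mulr1.
Qed.

(** The remainder [scale qX N F] has constant term 1, and its u^j coefficient with j > 0 is
    divisible by q^(N j), so it cannot affect q^m when m < N. *)
Lemma Fgen_coef_prod n m N : (m < N)%N ->
  (\prod_(k < N) (numer k * (uinv (denom k) : U)) : U) n m = F n m.
Proof.
move=> lt_mN; rewrite [in RHS](Fgen_prod N) coef_fpsM.
(* The last summand pairs the u^n coefficient of the product with the constant term 1. *)
rewrite big_ord_recr /= subnn [scale _ _ _ 0%N]/scale FgenE rho0 mul0n expr0 !mulr1.
rewrite coef_fpsD.
suff -> : (\sum_(i < n) (\prod_(k < N) (numer k * (uinv (denom k) : U)) : U) i
   * scale qX N F (n - i)%N) m = 0 by rewrite add0r.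
elim/big_rec: _ => [|i f _ IH]; first by rewrite [LHS]if_same.
rewrite coef_fpsD IH addr0 /scale fps_monoX mulrCA coef_fps_monoM leqNgt.
rewrite (leq_trans lt_mN) // leq_pmull // subn_gt0; exact: ltn_ord.
Qed.
End Product.

Theorem theorem5p2 (K : fieldType) (x y z b : K) :
  x != 0 -> x != y ->
  converges_to
    (fun N : nat =>
       \big[@umul K/uone K]_(k < N)
         (let E := eq_exp ((x - y)) k.+1 in
          let Nk := uadd (uone K) (uopp (umul (uconst (x^-1 * y)) E)) in
          let Dk := uadd (uone K)
                      (uadd (uopp (umono (b * (z - y)) k))
                            (uopp (umul (uconst (x^-1 * y))
                                        (umul (uadd (uone K) (umono (b * (x - z)) k)) E)))) in
          umul Nk (uinv Dk)))
    (Fgen x y z b).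
Proof.
move=> x_neq0 neq_xy n m; exists m.+1 => N lt_mN.
exact: Fgen_coef_prod.
Qed.
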